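(* Let $G$ be the Grigorchuk group. For $n\ge 1$, let $\Gamma_n$ be the Schreier graph of the action of $G$ on $\{0,1\}^n$ with respect to the generating set $\{a,b,c,d\}$, and let $d_n$ be the associated graph distance on $\{0,1\}^n$. Then for every non-trivial element $g\in G$, there exist $n\ge 1$ and $w\in\{0,1\}^n$ such that $d_n(gw,w)\ge \frac18\,\mathrm{diam}(\Gamma_n)$. In particular, $G$ belongs to $\mathcal{C}_{\mathrm{CD}}(\mathrm{lin})$.
   Context: Grigorchuk group: the group of automorphisms of the rooted binary tree $\{0,1\}^*$ of finite binary words generated by $a,b,c,d$, where $a(0w)=1w$, $a(1w)=0w$; $b(0w)=0a(w)$, $b(1w)=1c(w)$; $c(0w)=0a(w)$, $c(1w)=1d(w)$; $d(0w)=0w$, $d(1w)=1b(w)$ (and all fix the empty word). Schreier graph. For a group $G$ with finite symmetric generating set $S$ and a $G$-set $X$, the Schreier graph $\Gamma(G,X)$ has vertex set $X$ and edges $(x,sx)$, $x\in X$, $s\in S$; $d$ denotes its graph distance. For a $G$-orbit $O$, $\Gamma(G,O)$ is the corresponding connected component. Orbits of controlled diameter. The $G$-action on $X$ has orbits of controlled diameter if all $G$-orbits in $X$ are finite and there is $C>0$ such that for every non-trivial $g\in G$ there exist a $G$-orbit $O$ in $X$ and $x\in O$ with $gx\neq x$ and $\mathrm{diam}(\Gamma(G,O))\le C\,d(x,gx)$. This does not depend on the choice of $S$. $\mathcal{C}_{\mathrm{CD}}(\mathrm{lin})$ is the class of finitely generated groups $G$ admitting a $G$-set $X$ such that the action has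 orbits of controlled diameter and such that there is $C>0$ with $\max_{x\in X}|B_G(n)\cdot x|\le Cn$ for all $n\ge 1$, where $B_G(n)$ is the ball of radius $n$ around the identity in the word metric. *)

(* Defs.v *)
From HB Require Import structures.
From mathcomp Require Import all_boot all_order all_algebra.
From mathcomp Require Import finmap.
From mathcomp Require Import boolp classical_sets functions cardinality.
From mathcomp Require Import reals constructive_ereal ereal.

Set Implicit Arguments.
Unset Strict Implicit.
Unset Printing Implicit Defensive.

Local Open Scope classical_set_scope.
Local Open Scope group_scope.

Section Generation.
Variable G : groupType.
Implicit Type S : set G.

Definition is_subgroup (H : set G) : Prop := group_closed (mem H).

Definition generated S : set G := smallest is_subgroup S.

Definition sym_gen_set S : Prop :=
  [/\ finite_set S, forall s, S s -> S s^-1 & generated S = setT].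

(* This is the ball of the word metric when S is symmetric; inverses of elements
   of S are not allowed in the products. *)
Definition word_ball S (n : nat) : set G :=
  [set \prod_(s <- l) s | l in [set l : seq G |
                                 (size l <= n)%N /\ forall s, s \in l -> S s]].

End Generation.

Record gset (G : groupType) := GSet {
  gset_sort :> choiceType;
  gact : G -> gset_sort -> gset_sort;
  gact1 : forall x, gact 1 x = x;
  gactM : forall g h x, gact (g * h) x = gact g (gact h x)
}.

Section Schreier.
Variables (R : realType) (G : groupType).
Implicit Type S : set G.

Definition gorbit (X : gset G) (x : X) : set X := [set gact g x | g in setT].

Definition gorbits (X : gset G) : set (set X) := range (@gorbit X).

Definition schreier_edge S (X : gset G) : rel X :=
  fun x y => `[< exists2 s, S s & y = gact s x >].

(* The value is +oo when x and y lie in different components. *)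
Definition schreier_dist S (X : gset G) (x y : X) : \bar R :=
  ereal_inf [set ((size p)%:R%:E)%R |
    p in [set p : seq X | path (@schreier_edge S X) x p /\ last x p = y]].

(* A path of the Schreier graph starting in an orbit stays in that orbit, so
   for A an orbit this is the diameter of the component Gamma(G, A). *)
Definition schreier_diam S (X : gset G) (A : set X) : \bar R :=
  ereal_sup [set schreier_dist S u.1 u.2 | u in A `*` A].

Definition controlled_diameter S (X : gset G) : Prop :=
  (forall O, @gorbits X O -> finite_set O) /\
  exists2 C : R, (0 < C)%R & forall g : G, g != 1 ->
    exists O (x : X), [/\ gorbits O, O x, gact g x != x &
      (schreier_diam S O <= C%:E * schreier_dist S x (gact g x))%E].

Definition linear_ball_orbits S (X : gset G) : Prop :=
  exists2 C : R, (0 < C)%R & forall n : nat, (1 <= n)%N -> forall x : X,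
    ((#|` fset_set [set gact g x | g in word_ball S n]|)%:R <= C * n%:R)%R.

(* Neither condition on X depends on the choice of the finite symmetric
   generating set S, so a single S serves for finite generation and for both. *)
Definition CCD_lin : Prop :=
  exists2 S, sym_gen_set S &
    exists X : gset G, controlled_diameter S X /\ linear_ball_orbits S X.

End Schreier.

(* The rooted binary tree: the vertices are the finite words over {0, 1}, with
   false for 0 and true for 1, and the root is the empty word. *)
Definition tree_adj (u v : seq bool) : bool :=
  [exists x : bool, (v == rcons u x) || (u == rcons v x)].

Definition is_tree_aut (f : seq bool -> seq bool) : Prop :=
  [/\ bijective f, f [::] = [::] &
      forall u v, tree_adj (f u) (f v) = tree_adj u v].

Record tree_aut := TreeAut {
  aut_fun :> seq bool -> seq bool;
  aut_funP : `[< is_tree_aut aut_fun >]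
}.

HB.instance Definition _ := [isSub for aut_fun].
HB.instance Definition _ := [Choice of tree_aut by <:].

Lemma tree_autP (f : tree_aut) : is_tree_aut f.
Proof. exact/asboolP/aut_funP. Qed.

Lemma tree_aut_eq (f g : tree_aut) : f =1 g -> f = g.
Proof. by move=> fg; apply/val_inj/funext. Qed.

Lemma id_tree_aut : is_tree_aut id.
Proof. by split=> //; exists id. Qed.

Lemma comp_tree_aut (f g : tree_aut) : is_tree_aut (f \o g).
Proof.
have [bf f0 fA] := tree_autP f; have [bg g0 gA] := tree_autP g.
split; first exact: bij_comp.
- by rewrite /= g0.
- by move=> u v /=; rewrite fA gA.
Qed.

Lemma tree_aut_inv_ex (f : tree_aut) :
  exists g : tree_aut, cancel f g /\ cancel g f.
Proof.
have [[g fK gK] f0 fA] := tree_autP f.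
have gP : is_tree_aut g.
  split; first by exists f.
  - by rewrite -f0 fK.
  - by move=> u v; rewrite -fA !gK.
by exists (TreeAut (asboolT gP)).
Qed.

Definition tree_aut_one : tree_aut := TreeAut (asboolT id_tree_aut).
(* (f * g) w = f (g w), unlike the product of permutations in perm.v. *)
Definition tree_aut_mul (f g : tree_aut) : tree_aut :=
  TreeAut (asboolT (comp_tree_aut f g)).
Definition tree_aut_inv (f : tree_aut) : tree_aut := sval (cid (tree_aut_inv_ex f)).

Lemma tree_aut_mulA : associative tree_aut_mul.
Proof. by move=> f g h; apply: tree_aut_eq. Qed.

Lemma tree_aut_mul1 : left_id tree_aut_one tree_aut_mul.
Proof. by move=> f; apply: tree_aut_eq. Qed.

Lemma tree_aut_mulr1 : right_id tree_aut_one tree_aut_mul.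
Proof. by move=> f; apply: tree_aut_eq. Qed.

Lemma tree_aut_mulV : left_inverse tree_aut_one tree_aut_inv tree_aut_mul.
Proof.
by move=> f; apply: tree_aut_eq => w; rewrite /= /tree_aut_inv; case: cid => g [].
Qed.

Lemma tree_aut_mulrV : right_inverse tree_aut_one tree_aut_inv tree_aut_mul.
Proof.
by move=> f; apply: tree_aut_eq => w; rewrite /= /tree_aut_inv; case: cid => g [].
Qed.

HB.instance Definition _ := isGroup.Build tree_aut tree_aut_mulA
  tree_aut_mul1 tree_aut_mulr1 tree_aut_mulV tree_aut_mulrV.

Lemma tree_adjP u v :
  reflect (exists x, v = rcons u x \/ u = rcons v x) (tree_adj u v).
Proof.
apply: (iffP existsP) => -[x]; first by case/orP => /eqP; exists x; auto.
by case=> ->; exists x; rewrite eqxx ?orbT.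
Qed.

Lemma tree_aut_rcons (f : tree_aut) u x : exists y, f (rcons u x) = rcons (f u) y.
Proof.
have [bf f0 fA] := tree_autP f.
elim/last_ind: u x => [|u z IH] x.
  have /tree_adjP[y] : tree_adj (f [::]) (f [:: x]).
    by rewrite fA; apply/tree_adjP; exists x; left.
  by rewrite /= f0; case=> [->|]; [exists y | case: (f [:: x])].
have [t ft] := IH z.
have /tree_adjP[y [->|]] : tree_adj (f (rcons u z)) (f (rcons (rcons u z) x)).
- by rewrite fA; apply/tree_adjP; exists x; left.
- by exists y.
rewrite ft => /rcons_inj[/(bij_inj bf)/(congr1 size)].
by rewrite !size_rcons => /eqP; rewrite -addn2 -[X in X == _]addn0 eqn_add2l.
Qed.

Lemma size_tree_aut (f : tree_aut) w : size (f w) = size w.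
Proof.
elim/last_ind: w => [|w x IH]; first by have [_ ->] := tree_autP f.
by have [y ->] := tree_aut_rcons f w x; rewrite !size_rcons IH.
Qed.

Definition grig_a (w : seq bool) : seq bool :=
  if w is x :: v then ~~ x :: v else [::].

Fixpoint grig_b (w : seq bool) : seq bool :=
  match w with
  | [::] => [::]
  | false :: v => false :: grig_a v
  | true :: v => true :: grig_c v
  end
with grig_c (w : seq bool) : seq bool :=
  match w with
  | [::] => [::]
  | false :: v => false :: grig_a v
  | true :: v => true :: grig_d v
  end
with grig_d (w : seq bool) : seq bool :=
  match w with
  | [::] => [::]
  | false :: v => false :: v
  | true :: v => true :: grig_b v
  end.

Lemma involutive_tree_aut (f : seq bool -> seq bool) :
  involutive f -> f [::] = [::] ->
  (forall u x, exists y, f (rcons u x) = rcons (f u) y) -> is_tree_aut f.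
Proof.
move=> fK f0 fr.
have fA u v : tree_adj u v -> tree_adj (f u) (f v).
  case/tree_adjP => x [->|->]; [have [y ->] := fr u x|have [y ->] := fr v x];
    by apply/tree_adjP; exists y; auto.
split=> //; first by exists f.
by move=> u v; apply/idP/idP => [/fA|/fA //]; rewrite !fK.
Qed.

Lemma grig_aK : involutive grig_a.
Proof. by case=> //= x w; rewrite negbK. Qed.

Lemma grig_bcdK w :
  [/\ grig_b (grig_b w) = w, grig_c (grig_c w) = w & grig_d (grig_d w) = w].
Proof. by elim: w => [|[] w [bK cK dK]] //=; rewrite ?grig_aK ?bK ?cK ?dK. Qed.

Lemma grig_a_rcons u x : exists y, grig_a (rcons u x) = rcons (grig_a u) y.
Proof. by case: u => [|z u]; [exists (~~ x) | exists x]. Qed.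

Lemma grig_bcd_rcons u x :
  [/\ exists y, grig_b (rcons u x) = rcons (grig_b u) y,
      exists y, grig_c (rcons u x) = rcons (grig_c u) y &
      exists y, grig_d (rcons u x) = rcons (grig_d u) y].
Proof.
elim: u => [|[] u [[y1 b1] [y2 c1] [y3 d1]]] /=.
- by case: x; split; eexists.
- by split; [exists y2; rewrite c1 | exists y3; rewrite d1 | exists y1; rewrite b1].
- have [y a1] := grig_a_rcons u x.
  by split; [exists y; rewrite a1 | exists y; rewrite a1 | exists x].
Qed.

Lemma grig_aP : is_tree_aut grig_a.
Proof. by apply: involutive_tree_aut grig_aK _ grig_a_rcons. Qed.

Lemma grig_bP : is_tree_aut grig_b.
Proof.
by apply: involutive_tree_aut => // [w|u x];
  [have [] := grig_bcdK w | have [] := grig_bcd_rcons u x].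
Qed.

Lemma grig_cP : is_tree_aut grig_c.
Proof.
by apply: involutive_tree_aut => // [w|u x];
  [have [] := grig_bcdK w | have [] := grig_bcd_rcons u x].
Qed.

Lemma grig_dP : is_tree_aut grig_d.
Proof.
by apply: involutive_tree_aut => // [w|u x];
  [have [] := grig_bcdK w | have [] := grig_bcd_rcons u x].
Qed.

Definition aut_a : tree_aut := TreeAut (asboolT grig_aP).
Definition aut_b : tree_aut := TreeAut (asboolT grig_bP).
Definition aut_c : tree_aut := TreeAut (asboolT grig_cP).
Definition aut_d : tree_aut := TreeAut (asboolT grig_dP).

Definition grig_set : set tree_aut := generated [set aut_a; aut_b; aut_c; aut_d].

Lemma grig_set_closed : group_closed (mem grig_set).
Proof.
split; first by apply/mem_set => H [[H1 _] _]; apply/set_mem.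
move=> f g /set_mem fG /set_mem gG; apply/mem_set => H HP.
have [[_ HV] _] := HP.
by apply/set_mem/HV; apply/mem_set; [apply: fG | apply: gG].
Qed.

Record grigorchuk := Grigorchuk {
  grig_val :> tree_aut;
  grig_valP : grig_val \in mem grig_set
}.

HB.instance Definition _ := [isSub for grig_val].
HB.instance Definition _ := [Choice of grigorchuk by <:].
HB.instance Definition _ :=
  SubChoice_isSubGroup.Build tree_aut (mem grig_set) grigorchuk grig_set_closed.

Lemma grig_gen_mem f :
  [set aut_a; aut_b; aut_c; aut_d] f -> f \in mem grig_set.
Proof. by move=> Sf; apply/mem_set; apply: sub_smallest Sf. Qed.

Definition gen_a : grigorchuk := Grigorchuk (grig_gen_mem (or_introl (or_introl (or_introl erefl)))).
Definition gen_b : grigorchuk := Grigorchuk (grig_gen_mem (or_introl (or_introl (or_intror erefl)))).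
Definition gen_c : grigorchuk := Grigorchuk (grig_gen_mem (or_introl (or_intror erefl))).
Definition gen_d : grigorchuk := Grigorchuk (grig_gen_mem (or_intror erefl)).

Definition grig_gens : set grigorchuk := [set gen_a; gen_b; gen_c; gen_d].

Lemma level_actP (g : grigorchuk) n (w : n.-tuple bool) : size (g w) == n.
Proof. by rewrite size_tree_aut size_tuple. Qed.

Definition level_act n (g : grigorchuk) (w : n.-tuple bool) : n.-tuple bool :=
  Tuple (level_actP g w).

Lemma level_act1 n (w : n.-tuple bool) : level_act 1 w = w.
Proof. exact: val_inj. Qed.

Lemma level_actM n (g h : grigorchuk) (w : n.-tuple bool) :
  level_act (g * h) w = level_act g (level_act h w).
Proof. exact: val_inj. Qed.

Definition level (n : nat) : gset grigorchuk :=
  GSet (@level_act1 n) (@level_actM n).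

(* Main.v *)
Require Import Defs.
From HB Require Import structures.
From mathcomp Require Import all_boot all_order all_algebra.
From mathcomp Require Import finmap.
From mathcomp Require Import boolp classical_sets functions cardinality.
From mathcomp Require Import reals constructive_ereal ereal.
From mathcomp Require Import zify.

Import Order.TTheory GRing.Theory Num.Theory.

(** The Schreier graph of level n is, up to loops and multiple edges, a segment
    with 2 ^ n vertices: a flips the first letter, and at every word all but one
    of b, c, d flip the letter that follows the first 0, while the remaining one
    fixes the word. Flipping either the first bit or the bit after the first 1
    is the step rule of the binary Gray code, so after exchanging 0 and 1 the
    position [pos] of a word along the segment is its Gray decoding, the first
    letter being least significant. Hence graph distance is difference of
    positions ([schreier_distE]) and the diameter is at most 2 ^ n - 1.

    Let g be non-trivial and m the first level on which it moves a word. At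
    that level g only changes last letters, that is, it exchanges t0 and t1 for
    some words t of length m - 1. Flipping the most significant Gray digit
    reverses the segment, so such a word is moved by 2 ^ m - 1 - 2 * pos t,
    which is large unless t is near the end of its segment, t0 and t1 being then
    near the middle of theirs. For m <= 3 any displacement is enough. For m >= 4
    one avoids the middle by a parity argument. Label every vertex by whether g
    exchanges the two letters below it, and fix a vertex u. The number of
    labels equal to 1 at depths 1, 2 and 3 below u is even for every element of
    the group: this count modulo 2 is additive along products, and it vanishes
    on a, b, c, d because on the ray 1, 11, 111, ... each of b, c, d has exactly
    two labels out of any three consecutive ones beside the ray ([parity3_grig]).
    As g fixes all levels before m, only depth 3 below a word u of length m - 4
    contributes, so active words u ++ v with v of length 3 come at least in
    pairs. One of them has v different from 110, the last position at level 3;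
    then pos (u ++ v) < 7 * 2 ^ (m - 4), and the displacement exceeds
    2 ^ (m - 3) ([large_displacement]).

    For the second part, the group acts on the set of all words. Orbits
    are contained in levels, the first part gives controlled diameter with
    constant 8, and a ball of radius n moves a word within the interval of
    radius n about its position, which has at most 2 n + 1 <= 3 n points. *)

(** * The position of a word on the segment *)

Fixpoint pos (w : seq bool) : nat :=
  if w is x :: v then (odd (pos v) (+) ~~ x) + (pos v).*2 else 0.

Definition gap (u v : seq bool) : nat := (pos u - pos v) + (pos v - pos u).

Lemma gap_triangle v u w : gap u w <= gap u v + gap v w.
Proof. by rewrite /gap; lia. Qed.

(** Binary shift on positions is deletion of the first letter, so each step of
    the Gray decoding is recovered by halving. *)
Lemma pos_half x v : (pos (x :: v))./2 = pos v.
Proof. by rewrite /= half_bit_double. Qed.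

Lemma odd_pos x v : odd (pos (x :: v)) = odd (pos v) (+) ~~ x.
Proof. by rewrite /= oddD odd_double addbF oddb. Qed.

Lemma pos_lt w : pos w < 2 ^ size w.
Proof.
elim: w => //= x v IH; rewrite expnS.
by case: (_ (+) _) => /=; lia.
Qed.

Lemma pos_inj u v : size u = size v -> pos u = pos v -> u = v.
Proof.
elim: u v => [|x u IH] [|y v] // [suv] puv.
have puv' : pos u = pos v by rewrite -(pos_half x u) -(pos_half y v) puv.
have := congr1 odd puv; rewrite !odd_pos puv' => /addbI/negb_inj ->.
by rewrite (IH v).
Qed.

(** The trailing letters are the leading binary digits of the position: [v]
    determines in which of the intervals of length 2 ^ size u the word lies. *)
Lemma pos_cat u v : pos (u ++ v) < 2 ^ size u * (pos v).+1.
Proof.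
elim: u => [|x u IH] /=; first by rewrite expn0; lia.
by rewrite expnS; case: (_ (+) _) => /=; lia.
Qed.

(** The segment of level n + 1 consists of two copies of that of level n, the
    second one reversed: every digit of the decoding is a sum of Gray digits up
    to the most significant one, so changing the last letter complements all of
    them. *)
Lemma pos_rcons u :
  pos (rcons u true) = pos u /\
  pos (rcons u false) = 2 ^ (size u).+1 - (pos u).+1.
Proof.
elim: u => [|x u [IHt IHf]] //=; split; first by rewrite IHt.
have := pos_lt u; rewrite IHf [2 ^ (size u).+2]expnS expnS => lt_u.
rewrite oddB; last by lia.
rewrite oddM /=.
by case: (odd (pos u)) x => -[] /=; lia.
Qed.

(** The common non-trivial value of b, c, d: it flips the letter after the first
    0. *)
Fixpoint inner_move (w : seq bool) : seq bool :=
  match w with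
  | [::] => [::]
  | false :: v => false :: grig_a v
  | true :: v => true :: inner_move v
  end.

(** Which of the three fixes [w] depends on the number of leading 1s modulo 3,
    since b, c, d are permuted cyclically by each 1. *)
Lemma grig_bcd_inner w :
  [\/ [/\ grig_b w = inner_move w, grig_c w = inner_move w & grig_d w = w],
      [/\ grig_b w = inner_move w, grig_c w = w & grig_d w = inner_move w] |
      [/\ grig_b w = w, grig_c w = inner_move w & grig_d w = inner_move w]].
Proof.
elim: w => [|[] w IH] /=; [by constructor 1 | | by constructor 1].
by case: IH => -[-> -> ->]; [constructor 2 | constructor 3 | constructor 1].
Qed.

(** The edges of a match the positions 2 k and 2 k + 1, those of [inner_move]
    the positions 2 k + 1 and 2 k + 2; together they form a segment. *)
Lemma pos_grig_a x v :
  pos (grig_a (x :: v)) =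
  if odd (pos (x :: v)) then (pos (x :: v)).-1 else (pos (x :: v)).+1.
Proof. by rewrite odd_pos /=; case: (odd _) x => -[] /=; lia. Qed.

Lemma pos_inner_move w :
  pos (inner_move w) =
  if odd (pos w) then minn (pos w).+1 (2 ^ size w).-1 else (pos w).-1.
Proof.
elim: w => [|[] w IH] //.
  rewrite odd_pos [inner_move _]/=.
  have := pos_lt w.
  rewrite [pos (true :: inner_move w)]/= IH /= expnS.
  case: ifP => /=; rewrite ?addbT ?addbF ?oddS /=; lia.
case: w {IH} => [|x v] //.
rewrite odd_pos [inner_move _]/=.
have := pos_lt (x :: v).
rewrite -/(grig_a (x :: v)).
have -> : pos (false :: grig_a (x :: v)) =
  (odd (pos (grig_a (x :: v))) (+) true) + (pos (grig_a (x :: v))).*2 by [].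
rewrite pos_grig_a.
have -> : pos (false :: x :: v) =
  (odd (pos (x :: v)) (+) true) + (pos (x :: v)).*2 by [].
rewrite [size (false :: _)]/= -/(size (x :: v)).
move: (pos (x :: v)) => p; rewrite (expnS 2 (size _)).
rewrite [size (x :: v)]/= expnS; move: (2 ^ size v) => N.
by case: ifP => odd_p lt_p; rewrite ?addbT ?addbF /=; lia.
Qed.

(** * Moving along the segment *)

Lemma gap_gen_le1 s w : grig_gens s -> gap w (s w) <= 1.
Proof.
have gap_a : gap w (grig_a w) <= 1.
  case: w => [|x v]; rewrite /gap ?pos_grig_a //.
  by case: ifP; lia.
have gap_inner : gap w (inner_move w) <= 1.
  by have := pos_lt w; rewrite /gap pos_inner_move; case: ifP; lia.
have gap0 : gap w w <= 1 by rewrite /gap; lia.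
by case=> [[[]|]|] -> //=; case: (grig_bcd_inner w) => -[bE cE dE]; rewrite ?bE ?cE ?dE.
Qed.

Lemma gap_act_prod l w :
  (forall s, s \in l -> grig_gens s) ->
  gap w ((\prod_(s <- l) s)%g w) <= size l.
Proof.
elim: l w => [|s l IH] w lS; first by rewrite big_nil /= /gap; lia.
rewrite big_cons /=.
have sS : grig_gens s by apply: lS; rewrite mem_head.
have lS' t : t \in l -> grig_gens t by move=> tl; apply: lS; rewrite inE tl orbT.
apply: leq_trans (gap_triangle ((\prod_(t <- l) t)%g w) _ _) _.
by rewrite -addn1 leq_add // ?IH // gap_gen_le1.
Qed.

(** Of the two neighbours of [u], given by a and by [inner_move], one lies on the
    side of [v]. *)
Lemma gen_towards u v :
  size u = size v -> u <> v ->
  exists2 s, grig_gens s & gap u v = (gap (s u) v).+1.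
Proof.
move=> suv nuv.
have npos : pos u <> pos v by move/(pos_inj _ _ suv).
have gens_a : grig_gens gen_a by do 3 left.
have gens_b : grig_gens gen_b by do 2 left; right.
have gens_c : grig_gens gen_c by left; right.
have gens_d : grig_gens gen_d by right.
have [f_inner|f_a] : gap u v = (gap (inner_move u) v).+1 \/
                     gap u v = (gap (grig_a u) v).+1.
- case: u suv nuv npos => [|x u] suv nuv npos; first by case: v suv nuv {npos}.
  have := pos_lt (x :: u); have := pos_lt v; rewrite -suv.
  rewrite /gap pos_grig_a pos_inner_move.
  by case: ifP; lia.
- case: (grig_bcd_inner u) => -[bE cE dE].
  + by exists gen_b => //=; rewrite bE.
  + by exists gen_b => //=; rewrite bE.
  + by exists gen_c => //=; rewrite cE.
- by exists gen_a.
Qed.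

(** * Parity of the labels *)

(** The portrait of [f]: whether it exchanges the two letters below [w]. *)
Definition act_label (f : seq bool -> seq bool) (w : seq bool) : bool :=
  last false (f (rcons w false)).

Fixpoint label_sum (k : nat) (F : seq bool -> bool) (u : seq bool) : bool :=
  if k is k'.+1 then
    label_sum k' F (rcons u false) (+) label_sum k' F (rcons u true)
  else F u.

Lemma act_labelE (f : tree_aut) w x :
  f (rcons w x) = rcons (f w) (x (+) act_label f w).
Proof.
have [y fy] := tree_aut_rcons f w false.
have [z fz] := tree_aut_rcons f w x.
rewrite /act_label fy last_rcons fz; congr rcons.
case: x fz => fz /=; last by move: fz; rewrite fy => /rcons_inj[].
suff : z <> y by case: z {fz} y {fy} => [] [].
have [bf _ _] := tree_autP f.
by move=> zy; move: fz; rewrite zy -fy => /(bij_inj bf)/rcons_inj[].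
Qed.

Lemma act_label_mul (f g : tree_aut) w :
  act_label (f * g)%g w = act_label f (g w) (+) act_label g w.
Proof. by rewrite {1}/act_label /= act_labelE act_labelE last_rcons addbC. Qed.

Lemma label_sum_add k F1 F2 u :
  label_sum k (fun w => F1 w (+) F2 w) u = label_sum k F1 u (+) label_sum k F2 u.
Proof. by elim: k u => //= k IH u; rewrite !IH addbACA. Qed.

Lemma label_sum_ext k F1 F2 u : F1 =1 F2 -> label_sum k F1 u = label_sum k F2 u.
Proof. by move=> e; elim: k u => //= k IH u; rewrite !IH. Qed.

(** A tree automorphism maps the descendants of [u] bijectively onto those of
    [g u], which removes the twist in the cocycle identity once summed. *)
Lemma label_sum_aut k F (g : tree_aut) u :
  label_sum k (fun w => F (g w)) u = label_sum k F (g u).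
Proof.
elim: k u => //= k IH u; rewrite !IH !act_labelE.
by case: (act_label g u) => //=; rewrite addbC.
Qed.

Definition parity3 (f : seq bool -> seq bool) (u : seq bool) : bool :=
  let F := act_label f in
  label_sum 1 F u (+) label_sum 2 F u (+) label_sum 3 F u.

Lemma parity3_mul (f g : tree_aut) u :
  parity3 (f * g)%g u = parity3 f (g u) (+) parity3 g u.
Proof.
have E k : label_sum k (act_label (f * g)%g) u =
    label_sum k (act_label f) (g u) (+) label_sum k (act_label g) u.
  rewrite (label_sum_ext _ _ _ _ (act_label_mul f g)).
  by rewrite (label_sum_add _ (fun w => act_label f (g w))) label_sum_aut.
by rewrite /parity3 !E [X in X (+) _]addbACA addbACA.
Qed.

(** Parities below the first letter are those of the section [h], so parities of
    a generator anywhere reduce to parities of generators at the root. *)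
Lemma parity3_section (f h : seq bool -> seq bool) x y u :
  (forall w, f (x :: w) = y :: h w) -> (forall w, size (h w) = size w) ->
  parity3 f (x :: u) = parity3 h u.
Proof.
move=> fE size_h.
have E k w : label_sum k (act_label f) (x :: w) = label_sum k (act_label h) w.
  elim: k w => [|k IH] w /=; last by rewrite !IH.
  rewrite /act_label /= fE /=.
  by case: (h _) (size_h (rcons w false)) => //; rewrite size_rcons.
by rewrite /parity3 !E.
Qed.

(** At the root, a has no label at depths 1 to 3, b is active at 0 and 10, c at
    0 and 110, d at 10 and 110. Deeper parities are those of the sections, which
    are again generators or trivial; this is why the identity joins the
    induction. *)
Lemma parity3_gens u :
  [/\ parity3 grig_a u = false, parity3 grig_b u = false,
      parity3 grig_c u = false & parity3 grig_d u = false].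
Proof.
suff [] : [/\ parity3 id u = false, parity3 grig_a u = false,
  parity3 grig_b u = false, parity3 grig_c u = false & parity3 grig_d u = false]
  by split.
elim: u => [|x u [E1 Ea Eb Ec Ed]] //=.
have size_a := size_tree_aut aut_a; have size_b := size_tree_aut aut_b.
have size_c := size_tree_aut aut_c; have size_d := size_tree_aut aut_d.
split.
- by rewrite (parity3_section id id x x).
- by rewrite (parity3_section grig_a id x (~~ x)).
- case: x; first by rewrite (parity3_section grig_b grig_c true true).
  by rewrite (parity3_section grig_b grig_a false false).
- case: x; first by rewrite (parity3_section grig_c grig_d true true).
  by rewrite (parity3_section grig_c grig_a false false).
- case: x; first by rewrite (parity3_section grig_d grig_b true true).
  by rewrite (parity3_section grig_d id false false).
Qed.

(** The automorphisms whose parities all vanish form a subgroup. *)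
Lemma parity3_grig (g : grigorchuk) u : parity3 g u = false.
Proof.
have := grig_valP g; move: (grig_val g) => f /set_mem fG {g}.
suff : [set f : tree_aut | forall u, parity3 f u = false]%classic f by exact.
apply: fG; split; last first.
  move=> s; case=> [[[]|]|] -> v /=; case: (parity3_gens v) => //.
have one : forall v, parity3 (1%g : tree_aut) v = false.
  move=> v; have := parity3_mul 1%g 1%g v; rewrite mulg1 /=.
  by case: (parity3 _ _).
split; first by apply/mem_set.
move=> s t /set_mem /= sE /set_mem /= tE; apply/mem_set => v /=.
rewrite parity3_mul sE /=.
by have := parity3_mul t (t^-1)%g v; rewrite mulgV one tE.
Qed.

(** * Displacement *)

Lemma first_moved_level (g : grigorchuk) :
  g != 1%g ->
  exists n, (forall u, size u <= n -> g u = u) /\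
    exists2 u, size u = n & act_label g u.
Proof.
move=> g1.
have [w gw] : exists w, g w <> w.
  apply/existsNP => gid; move/eqP: g1; apply; apply/val_inj.
  by apply: tree_aut_eq => w; rewrite gid.
have ex_n : exists n, `[< exists2 w, size w = n & g w <> w >].
  by exists (size w); apply/asboolP; exists w.
case: (ex_minnP ex_n) => m /asboolP[v size_v gv] m_min.
case/lastP: v => [|u x] in size_v gv *; first by have [_ g0 _] := tree_autP g.
rewrite size_rcons in size_v; exists (size u).
have fix_le t : size t <= size u -> g t = t.
  move=> size_t; apply: contrapT => gt.
  have : m <= size t by apply: m_min; apply/asboolP; exists t.
  by rewrite -size_v ltnNge size_t.
split=> //; exists u => //.
apply: contrapT => /negP/negbTE u0.
by apply: gv; rewrite act_labelE u0 addbF fix_le.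
Qed.

(** Labels at depths 1 and 2 below the word [u'] obtained by deleting three
    letters vanish, so by parity those at depth 3 have sum zero: a label at the
    word 110, the only one of position 7, forces another label. *)
Lemma moved_word_off_center (g : grigorchuk) u :
  (forall t, size t <= size u -> g t = t) -> act_label g u -> 3 <= size u ->
  exists u' v, [/\ size u = size u' + 3, size v = 3, act_label g (u' ++ v) & pos v <= 6].
Proof.
move=> fix_le gu size_u.
exists (take (size u - 3) u).
set u' := take _ u.
have size_u' : size u = size u' + 3 by rewrite size_takel; lia.
have lab0 t : size t < size u -> act_label g t = false.
  move=> size_t; have := act_labelE g t false.
  by rewrite !fix_le ?size_rcons ?(ltnW size_t) // => /rcons_inj[<-].
have sum0 : label_sum 3 (act_label g) u' = false.
  have := parity3_grig g u'.
  rewrite /parity3 [label_sum 1 _ _]/= [label_sum 2 _ _]/=.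
  by rewrite !lab0 ?size_rcons //; lia.
move: gu; rewrite -{1}(cat_take_drop (size u - 3) u) -/u'.
have : size (drop (size u - 3) u) = 3 by rewrite size_drop; lia.
move: (drop _ _) => v size_v gv.
have [v6|v7] := leqP (pos v) 6; first by exists v.
(* 110 is the last vertex of the segment of level 3. *)
have vE : v = [:: true; true; false].
  by move: v size_v v7 {gv} => [|[] [|[] [|[] []]]].
rewrite vE in gv; apply: contrapT => none.
have lab t : size t = 3 -> pos t <= 6 -> act_label g (u' ++ t) = false.
  move=> size_t pos_t; apply/negbTE/negP => gt.
  by apply: none; exists t.
by move: sum0; rewrite /= -!cats1 -!catA /= gv !lab.
Qed.

Lemma large_displacement (g : grigorchuk) :
  g != 1%g ->
  exists2 w, 1 <= size w & g w <> w /\ 2 ^ size w - 1 <= 8 * gap w (g w).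
Proof.
move=> /first_moved_level[n [fix_le [u size_u gu]]].
have swap t : size t = n -> act_label g t ->
    [/\ g (rcons t true) = rcons t false, size (rcons t true) = n.+1 &
        gap (rcons t true) (rcons t false) = 2 ^ n.+1 - 1 - (pos t).*2].
  move=> size_t gt; rewrite act_labelE gt fix_le ?size_t // size_rcons size_t.
  have [pos_t pos_f] := pos_rcons t; have := pos_lt t.
  by rewrite /gap pos_t pos_f size_t expnS; split=> //; lia.
have nontriv t : rcons t false <> rcons t true by move/rcons_inj => [].
(* Below length 3 the diameter is at most 7, and any displacement is enough. *)
have [n3|n2] := leqP 3 n; last first.
  have [gE size_w gapE] := swap u size_u gu.
  exists (rcons u true);
  rewrite size_w // gE gapE.
  have := pos_lt u; rewrite size_u expnS.
  by split=> //; have : 2 ^ n <= 2 ^ 2 by [rewrite leq_exp2l]; lia.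
rewrite -size_u in n3 fix_le.
have [u' [v [size_u' size_v guv pos_v]]] := moved_word_off_center g u fix_le gu n3.
have size_uv : size (u' ++ v) = n by rewrite size_cat size_v -size_u' size_u.
have [gE size_w gapE] := swap _ size_uv guv.
exists (rcons (u' ++ v) true);
  rewrite size_w // gE gapE.
split=> //.
have := pos_cat u' v.
have -> : 2 ^ n.+1 = 2 ^ size u' * 16.
  by rewrite -size_u size_u' -addnS expnD.
have : 2 ^ size u' * (pos v).+1 <= 2 ^ size u' * 7 by rewrite leq_mul2l ltnS pos_v orbT.
by lia.
Qed.

(** * Schreier distances *)

(** The map [phi] allows one treatment of the levels and of the action on all
    words: an equivariant injection into words transports positions. *)
Lemma gap_ge_path (X : gset grigorchuk) (phi : X -> seq bool) :
  (forall g x, phi (gact g x) = g (phi x)) ->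
  forall (p : seq X) x, path (@schreier_edge _ grig_gens X) x p ->
  gap (phi x) (phi (last x p)) <= size p.
Proof.
move=> phiE; elim=> [|y p IH] x /=; first by rewrite /gap; lia.
case/andP=> /asboolP[s sS ->] /IH le_p.
apply: leq_trans (gap_triangle (phi (gact s x)) _ _) _.
by rewrite -addn1 addnC leq_add // phiE gap_gen_le1.
Qed.

(** Moving greedily towards the target realizes the gap. *)
Lemma path_of_gap (X : gset grigorchuk) (phi : X -> seq bool) :
  injective phi -> (forall g x, phi (gact g x) = g (phi x)) ->
  forall x y : X, size (phi x) = size (phi y) ->
  exists p : seq X, [/\ path (@schreier_edge _ grig_gens X) x p,
    last x p = y & size p = gap (phi x) (phi y)].
Proof.
move=> phi_inj phiE x y; move Ek: (gap _ _) => k.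
elim: k x Ek => [|k IH] x Ek size_xy.
  exists nil; split=> //=; apply: phi_inj; apply: pos_inj => //.
  by move: Ek; rewrite /gap; lia.
have nxy : phi x <> phi y by move=> e; move: Ek; rewrite e /gap; lia.
have [s sS] := gen_towards _ _ size_xy nxy.
rewrite Ek -phiE => -[/esym/IH].
rewrite phiE size_tree_aut => /(_ size_xy)[p [xp lp sp]].
exists (gact s x :: p); split=> //=; last by rewrite sp.
by rewrite xp andbT; apply/asboolP; exists s.
Qed.

Lemma schreier_distE (R : realType) (X : gset grigorchuk) (phi : X -> seq bool) :
  injective phi -> (forall g x, phi (gact g x) = g (phi x)) ->
  forall x y : X, size (phi x) = size (phi y) ->
  schreier_dist R grig_gens x y = ((gap (phi x) (phi y))%:R%:E)%R.
Proof.
move=> phi_inj phiE x y size_xy; apply/eqP; rewrite eq_le; apply/andP; split.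
  have [p [xp lp <-]] := path_of_gap _ _ phi_inj phiE _ _ size_xy.
  by apply: ereal_inf_lbound; exists p.
apply: le_ereal_inf_tmp => _ [p [xp <-] <-].
by rewrite lee_fin ler_nat; apply: gap_ge_path.
Qed.

Lemma schreier_diam_le (R : realType) (X : gset grigorchuk) (phi : X -> seq bool)
    (A : set X) n :
  injective phi -> (forall g x, phi (gact g x) = g (phi x)) ->
  (forall x, A x -> size (phi x) = n) ->
  (schreier_diam R grig_gens A <= ((2 ^ n - 1)%:R%:E)%R)%E.
Proof.
move=> phi_inj phiE sizeA.
apply: ge_ereal_sup => _ [[x y] [/= Ax Ay] <-].
rewrite (schreier_distE _ _ phi) ?sizeA // lee_fin ler_nat.
have := pos_lt (phi x); have := pos_lt (phi y).
by rewrite !sizeA // /gap; lia.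
Qed.

Lemma diam_le_displacement (R : realType) (X : gset grigorchuk)
    (phi : X -> seq bool) (A : set X) (x y : X) n :
  injective phi -> (forall g x, phi (gact g x) = g (phi x)) ->
  (forall x, A x -> size (phi x) = n) -> A x -> A y ->
  2 ^ n - 1 <= 8 * gap (phi x) (phi y) ->
  (schreier_diam R grig_gens A <= (8%:R%:E)%R * schreier_dist R grig_gens x y)%E.
Proof.
move=> phi_inj phiE sizeA Ax Ay far.
apply: le_trans (schreier_diam_le _ _ _ _ _ phi_inj phiE sizeA) _.
rewrite (schreier_distE _ _ phi) ?sizeA //.
by rewrite -EFinM lee_fin -natrM ler_nat.
Qed.

(** * The action on all words *)

Lemma grig_gensV s : grig_gens s -> (s^-1 = s)%g.
Proof.
have invol (t : grigorchuk) : involutive t -> (t^-1 = t)%g.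
  move=> tK; apply/(mulgI t); rewrite mulgV; apply/val_inj.
  by apply: tree_aut_eq => w; rewrite /= tK.
by case=> [[[]|]|] ->; apply: invol => w /=; rewrite ?grig_aK //;
  case: (grig_bcdK w).
Qed.

(** The group is generated as a subgroup of the automorphism group; a
    subgroup of it is transported there by its image, to which minimality
    applies. *)
Lemma generated_grig_gens : generated grig_gens = [set: grigorchuk]%classic.
Proof.
apply/seteqP; split=> // g _ H [[H1 HV] HS].
suff : [set val h | h in H]%classic (val g) by case=> h Hh /val_inj <-.
have /set_mem := grig_valP g; apply; split; last first.
  move=> _ [[[]|]|] ->.
  - by exists gen_a => //; apply: HS; do 3 left.
  - by exists gen_b => //; apply: HS; do 2 left; right.
  - by exists gen_c => //; apply: HS; left; right.
  - by exists gen_d => //; apply: HS; right.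
split; first by apply/mem_set; exists 1%g => //; apply/set_mem.
move=> _ _ /set_mem[h Hh <-] /set_mem[k Hk <-]; apply/mem_set.
by exists (h / k)%g => //; apply/set_mem/HV; apply/mem_set.
Qed.

Lemma sym_gen_grig_gens : sym_gen_set grig_gens.
Proof.
split; last exact: generated_grig_gens.
  by rewrite /grig_gens !finite_setU; do !split; apply: finite_set1.
by move=> s sS; rewrite grig_gensV.
Qed.

Definition tree_gset : gset grigorchuk :=
  @GSet grigorchuk (seq bool) (fun g w => g w) (fun=> erefl) (fun _ _ _ => erefl).

Lemma finite_words n : finite_set [set w : seq bool | size w = n]%classic.
Proof.
have fin_tuples : finite_set [set: n.-tuple bool]%classic := finite_finset.
apply: sub_finite_set (finite_image (@tval n bool) fin_tuples).
by move=> w /eqP size_w; exists (Tuple size_w).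
Qed.

Lemma size_tree_orbit (x y : tree_gset) : gorbit x y -> size y = size x.
Proof. by case=> g _ <-; rewrite size_tree_aut. Qed.

Lemma tree_controlled_diameter (R : realType) :
  controlled_diameter R grig_gens tree_gset.
Proof.
split.
  move=> _ [x _ <-]; apply: sub_finite_set (finite_words (size (x : seq bool))).
  by move=> y /size_tree_orbit.
exists 8%:R%R; first by rewrite ltr0n.
move=> g /large_displacement[w _ [gw far]].
exists (gorbit (w : tree_gset)), w; split.
- by exists w.
- by exists 1%g.
- exact/eqP.
- apply: (diam_le_displacement R tree_gset id _ _ _ (size w)) => //.
  + exact: size_tree_orbit.
  + by exists 1%g.
  + by exists g.
Qed.

Lemma tree_linear_ball_orbits (R : realType) :
  linear_ball_orbits R grig_gens tree_gset.
Proof.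
exists 3%:R%R; first by rewrite ltr0n.
move=> n n_gt0 x; rewrite -natrM ler_nat.
set A := (X in fset_set X).
have A_ball y : A y -> size y = size x /\ gap x y <= n.
  case=> _ [l [l_n lS] <-] <-; rewrite size_tree_aut; split=> //.
  exact: leq_trans (gap_act_prod _ _ lS) l_n.
have A_fin : finite_set A.
  by apply: sub_finite_set (finite_words (size (x : seq bool))) => y /A_ball[].
rewrite -(size_map pos).
have uniq_pos : uniq [seq pos y | y <- fset_set A].
  rewrite map_inj_in_uniq ?fset_uniq // => y z.
  rewrite !in_fset_set // => /set_mem/A_ball[ys _] /set_mem/A_ball[zs _].
  by apply: pos_inj; rewrite ys zs.
have sub_iota : {subset [seq pos y | y <- fset_set A] <= iota (pos x - n) (2 * n + 1)}.
  move=> _ /mapP[y + ->]; rewrite in_fset_set // => /set_mem/A_ball[_].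
  by rewrite mem_iota /gap; lia.
apply: leq_trans (uniq_leq_size uniq_pos sub_iota) _.
by rewrite size_iota; lia.
Qed.

Theorem proposition2p14 (R : realType) :
  (forall g : grigorchuk, g != 1%g ->
     exists n : nat, (1 <= n)%N /\ exists w : level n,
       ((8%:R^-1)%R%:E * schreier_diam R grig_gens [set: level n] <=
          schreier_dist R grig_gens (gact g w) w)%E) /\
  CCD_lin R grigorchuk.
Proof.
split.
  move=> g /large_displacement[w size_w [_ far]].
  exists (size w); split=> //; exists (in_tuple w : level (size w)).
  rewrite lee_pdivrMl ?ltr0n //.
  apply: (diam_le_displacement R (level (size w)) (@tval (size w) bool) _ _ _ (size w)) => //.
  - exact: val_inj.
  - by move=> v _; rewrite size_tuple.
  - by rewrite /gap addnC.
exists grig_gens; first exact: sym_gen_grig_gens.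
exists tree_gset; split.
- exact: tree_controlled_diameter.
- exact: tree_linear_ball_orbits.
Qed.
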